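(* Denote by $PMV_1$, $PMV_f$, $PMV$ and $MVW\text{-rig}$ the classes of unitary $PMV$-algebras, $PMV_f$-algebras, $PMV$-algebras and $MVW$-rigs respectively. Then $$PMV_1\subsetneq PMV_f\subseteq PMV\subsetneq MVW\text{-rig}.$$
   Context: An MV-algebra is $(A,\oplus,\neg,0)$ with $(A,\oplus,0)$ a commutative monoid, $\neg\neg x=x$, $x\oplus\neg 0=\neg 0$, $\neg(\neg x\oplus y)\oplus y=\neg(\neg y\oplus x)\oplus x$. Put $u=\neg 0$, $x\odot y=\neg(\neg x\oplus\neg y)$, $x\ominus y=\neg(\neg x\oplus y)$; the lattice order is $x\le y\iff x\ominus y=0$. An MV-algebra with product is $(A,\oplus,\cdot,\neg,0)$ with $(A,\oplus,\neg,0)$ an MV-algebra and $(A,\cdot)$ a semigroup; all products are assumed commutative. Such a structure is: - an $MVW$-rig if for all $a,b,c$: $a0=0a=0$; $a(b\oplus c)\le ab\oplus ac$; $ab\ominus ac\le a(b\ominus c)$; - a $PMV$-algebra if for all $a,b,c$: $a\odot b=0$ implies $ac\odot bc=0$, and $a\odot b=0$ implies $c(a\oplus b)=ca\oplus cb$; - a $PMV_f$-algebra if it is an $MVW$-rig and for all $a,b,c$: $ab\le a\wedge b$ and $a(b\ominus c)=ab\ominus ac$; - a unitary $PMV$-algebra ($PMV_1$-algebra) if for all $a,b,c$: $au=a$ and $a(b\ominus c)=ab\ominus ac$. *)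

(* Defs.v *)
From mathcomp Require Import all_boot.
From mathcomp Require Import classical_sets.
Set Implicit Arguments.
Unset Strict Implicit.
Unset Printing Implicit Defensive.

Declare Scope mv_scope.
Delimit Scope mv_scope with MV.
Local Open Scope mv_scope.

Record mvAlgebra : Type := MVAlgebra {
  mv_sort :> Type;
  mv_zero : mv_sort;
  mv_add : mv_sort -> mv_sort -> mv_sort;
  mv_neg : mv_sort -> mv_sort;
  mv_addA : forall x y z, mv_add x (mv_add y z) = mv_add (mv_add x y) z;
  mv_addC : forall x y, mv_add x y = mv_add y x;
  mv_add0 : forall x, mv_add x mv_zero = x;
  mv_negK : forall x, mv_neg (mv_neg x) = x;
  mv_addN0 : forall x, mv_add x (mv_neg mv_zero) = mv_neg mv_zero;
  mv_lukasiewicz : forall x y,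
    mv_add (mv_neg (mv_add (mv_neg x) y)) y =
    mv_add (mv_neg (mv_add (mv_neg y) x)) x
}.

Arguments mv_zero {_}.

Notation "0" := mv_zero : mv_scope.
Notation "x ⊕ y" := (mv_add x y) (at level 50, left associativity) : mv_scope.
Notation "¬ x" := (mv_neg x) (at level 35, right associativity) : mv_scope.

Section DerivedOperations.
Variable A : mvAlgebra.
Implicit Types x y z : A.

Definition mv_unit : A := ¬ 0.
Definition mv_mul x y : A := ¬ (¬ x ⊕ ¬ y).
Definition mv_sub x y : A := ¬ (¬ x ⊕ y).
Definition mv_le x y : Prop := mv_sub x y = 0.
(* The standard term for the infimum of the order [mv_le]; see [mv_le_meet]. *)
Definition mv_meet x y : A := mv_mul x (¬ x ⊕ y).

End DerivedOperations.

Arguments mv_unit {A}.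

Notation "x ⊙ y" := (mv_mul x y) (at level 40, left associativity) : mv_scope.
Notation "x ⊖ y" := (mv_sub x y) (at level 50, left associativity) : mv_scope.
Notation "x ⊓ y" := (mv_meet x y) (at level 40, left associativity) : mv_scope.
Notation "x ≤ y" := (mv_le x y) (at level 70, no associativity) : mv_scope.

Section Meet.
Variable A : mvAlgebra.
Implicit Types x y z : A.

Lemma mv_addNx x : ¬ x ⊕ x = mv_unit.
Proof.
have := mv_lukasiewicz (mv_unit : A) x.
by rewrite /mv_unit mv_negK (mv_addC 0) mv_add0 !mv_addN0.
Qed.

Lemma mv_leE x y : x ≤ y <-> ¬ x ⊕ y = mv_unit.
Proof.
rewrite /mv_le /mv_sub; split=> [E|->]; last exact: mv_negK.
by rewrite -[LHS]mv_negK E.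
Qed.

Lemma mv_le_addl x y : x ≤ y ⊕ x.
Proof. by apply/mv_leE; rewrite (mv_addC y) mv_addA mv_addNx mv_addC mv_addN0. Qed.

Lemma mv_le_sub_add x y : x ≤ y -> y = (y ⊖ x) ⊕ x.
Proof.
by move=> le_xy; rewrite /mv_sub mv_lukasiewicz (le_xy : ¬ (¬ x ⊕ y) = 0) mv_addC mv_add0.
Qed.

Lemma mv_le_add2r z x y : x ≤ y -> x ⊕ z ≤ y ⊕ z.
Proof.
move=> /mv_le_sub_add ->; rewrite -mv_addA; exact: mv_le_addl.
Qed.

Lemma mv_leN x y : x ≤ y <-> ¬ y ≤ ¬ x.
Proof. by rewrite !mv_leE mv_negK mv_addC. Qed.

Lemma mv_meetC x y : x ⊓ y = y ⊓ x.
Proof.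
rewrite /mv_meet /mv_mul; congr (¬ _).
have := mv_lukasiewicz (¬ y) (¬ x); rewrite !mv_negK.
by rewrite (mv_addC y) (mv_addC x) !(mv_addC (¬ (_ ⊕ _))).
Qed.

Lemma mv_meet_lel x y : x ⊓ y ≤ x.
Proof. by apply/mv_leN; rewrite /mv_meet /mv_mul mv_negK mv_addC; exact: mv_le_addl. Qed.

Lemma mv_le_meet z x y : z ≤ x ⊓ y <-> z ≤ x /\ z ≤ y.
Proof.
have tr (a b c : A) : a ≤ b -> b ≤ c -> a ≤ c.
  move=> ab bc; rewrite (mv_le_sub_add bc) (mv_le_sub_add ab) mv_addA.
  exact: mv_le_addl.
split=> [le_z|[/mv_leN le_x le_y]].
  by split; apply: tr le_z _; last rewrite mv_meetC; exact: mv_meet_lel.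
apply/mv_leN; rewrite /mv_meet /mv_mul mv_negK.
rewrite [X in _ ≤ X](mv_le_sub_add le_x) mv_addC.
apply: mv_le_add2r; rewrite /mv_sub -mv_leN mv_negK.
rewrite (mv_addC (¬ x)); exact: mv_le_add2r.
Qed.

End Meet.

Record mvProdAlgebra : Type := MVProdAlgebra {
  mvp_base :> mvAlgebra;
  mvp_prod : mvp_base -> mvp_base -> mvp_base;
  mvp_prodA : forall x y z,
    mvp_prod x (mvp_prod y z) = mvp_prod (mvp_prod x y) z;
  mvp_prodC : forall x y, mvp_prod x y = mvp_prod y x
}.

Notation "x · y" := (mvp_prod x y) (at level 40, left associativity) : mv_scope.

Definition MVW_rig : set mvProdAlgebra := fun A =>
  (forall a : A, a · 0 = 0 /\ 0 · a = 0) /\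
  (forall a b c : A, a · (b ⊕ c) ≤ a · b ⊕ a · c) /\
  (forall a b c : A, a · b ⊖ a · c ≤ a · (b ⊖ c)).

Definition PMV : set mvProdAlgebra := fun A =>
  (forall a b c : A, a ⊙ b = 0 -> (a · c) ⊙ (b · c) = 0) /\
  (forall a b c : A, a ⊙ b = 0 -> c · (a ⊕ b) = c · a ⊕ c · b).

Definition PMV_f : set mvProdAlgebra := fun A =>
  MVW_rig A /\
  (forall a b : A, a · b ≤ a ⊓ b) /\
  (forall a b c : A, a · (b ⊖ c) = a · b ⊖ a · c).

Definition PMV_1 : set mvProdAlgebra := fun A =>
  (forall a : A, a · mv_unit = a) /\
  (forall a b c : A, a · (b ⊖ c) = a · b ⊖ a · c).

(* Main.v *)
Require Import Defs.
From mathcomp Require Import all_boot.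
From mathcomp Require Import classical_sets.
Set Implicit Arguments.
Unset Strict Implicit.
Unset Printing Implicit Defensive.
Local Open Scope classical_set_scope.

(** Everything rests on two facts about MV-algebras: the residuation law
    [x ⊖ y ≤ z <-> x ≤ y ⊕ z], and the correspondence between differences
    [y ⊖ x] with [x ≤ y] and orthogonal sums, that is sums [a ⊕ b] with
    [a ⊙ b = 0]: [y = (y ⊖ x) ⊕ x] is an orthogonal sum
    ([mv_le_sub_add], [mv_sub_orthogonal]), and conversely
    [(a ⊕ b) ⊖ b = a] for orthogonal [a] and [b] ([mv_orthogonal_addK]).

    A product which distributes over [⊖] is monotone and kills 0.  If
    moreover the top element is neutral, monotonicity gives [a · b ≤ a ⊓ b],
    and residuation turns distributivity over [⊖] into subadditivity over
    [⊕]; so unitary PMV-algebras are PMV_f-algebras.  In a PMV_f-algebra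
    the inequality [a · b ≤ a] transports orthogonality, and distributivity
    over [⊖] becomes additivity on orthogonal sums.  In a PMV-algebra,
    additivity on the orthogonal sum [y = (y ⊖ x) ⊕ x] gives monotonicity
    and then both MVW-inequalities; [c · 0 = 0] holds because [c · 0] is
    both idempotent for [⊕] and orthogonal to itself.

    The two strict inclusions are witnessed on the three-element Łukasiewicz
    chain [{0, 1/2, 1}].  The zero product lies in PMV_f, but its top element is not neutral.
    The product of supports, equal to 1 whenever both factors are nonzero,
    satisfies the MVW-inequalities but sends the orthogonal pair
    [(1/2, 1/2)] to the pair [(1, 1)], which is not orthogonal. *)

Local Open Scope mv_scope.

(** * Order and orthogonality in MV-algebras *)

Section MVAlgebra.
Variable A : mvAlgebra.
Implicit Types x y z t : A.

Lemma mv_negu : ¬ (mv_unit : A) = 0.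
Proof. exact: mv_negK. Qed.

Lemma mv_le_refl x : x ≤ x.
Proof. by apply/mv_leE/mv_addNx. Qed.

Lemma mv_le0x x : 0 ≤ x.
Proof. by apply/mv_leE; rewrite mv_addC mv_addN0. Qed.

Lemma mv_lexu x : x ≤ mv_unit.
Proof. by apply/mv_leE/mv_addN0. Qed.

Lemma mv_le_trans y x z : x ≤ y -> y ≤ z -> x ≤ z.
Proof.
move=> xy yz; rewrite (mv_le_sub_add yz) (mv_le_sub_add xy) mv_addA.
exact: mv_le_addl.
Qed.

Lemma mv_le_add2l z x y : x ≤ y -> z ⊕ x ≤ z ⊕ y.
Proof. rewrite !(mv_addC z); exact: mv_le_add2r. Qed.

Lemma mv_subxx x : x ⊖ x = 0.
Proof. exact: mv_le_refl. Qed.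

(** Both sides say that [¬ x ⊕ y ⊕ z] is the top element. *)
Lemma mv_residuation x y z : x ⊖ y ≤ z <-> x ≤ y ⊕ z.
Proof. by rewrite !mv_leE /mv_sub mv_negK mv_addA. Qed.

(** The equation [x ⊙ y = 0] is an inequality in disguise: it is convertible
    to [x ≤ ¬ y], which makes monotonicity arguments available. *)
Lemma mv_orthogonalE x y : x ⊙ y = 0 <-> x ≤ ¬ y.
Proof. by []. Qed.

Lemma mv_orthogonal_le x y z t : x ≤ y -> z ≤ t -> y ⊙ t = 0 -> x ⊙ z = 0.
Proof.
move=> xy /mv_leN zt /mv_orthogonalE yt; apply/mv_orthogonalE.
exact: mv_le_trans xy (mv_le_trans yt zt).
Qed.

Lemma mv_sub_orthogonal x y : (y ⊖ x) ⊙ x = 0.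
Proof. by apply/mv_orthogonalE; rewrite /mv_sub -mv_leN; exact: mv_le_addl. Qed.

(** The left-hand side is always [¬ y ⊓ x], and orthogonality says precisely
    that [x] lies below [¬ y]. *)
Lemma mv_orthogonal_addK x y : x ⊙ y = 0 -> (x ⊕ y) ⊖ y = x.
Proof.
move=> /mv_orthogonalE/mv_leE xNy.
have -> : (x ⊕ y) ⊖ y = ¬ y ⊓ x.
  by rewrite /mv_meet /mv_mul /mv_sub mv_negK mv_addC (mv_addC x).
by rewrite mv_meetC /mv_meet xNy /mv_mul mv_negu mv_add0 mv_negK.
Qed.

Lemma mv_idempotent_orthogonal_eq0 x : x ⊕ x = x -> x ⊙ x = 0 -> x = 0.
Proof. by move=> xx /mv_orthogonal_addK <-; rewrite xx mv_subxx. Qed.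

End MVAlgebra.

(** * Products distributing over differences *)

Section SubDistributive.
Variable A : mvProdAlgebra.
Hypothesis prodB : forall a b c : A, a · (b ⊖ c) = a · b ⊖ a · c.
Implicit Types a b c : A.

Lemma prodB_x0 a : a · 0 = 0.
Proof. by have := prodB a 0 0; rewrite !mv_subxx. Qed.

Lemma prodB_mono a b c : b ≤ c -> a · b ≤ a · c.
Proof. by rewrite /mv_le -prodB => ->; exact: prodB_x0. Qed.

(** By residuation the claim is [a · ((b ⊕ c) ⊖ b) ≤ a · c], which is
    monotonicity applied to [(b ⊕ c) ⊖ b ≤ c]. *)
Lemma prodB_subadditive a b c : a · (b ⊕ c) ≤ a · b ⊕ a · c.
Proof.
apply/mv_residuation; rewrite -prodB; apply: prodB_mono.
by apply/mv_residuation/mv_le_refl.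
Qed.

Lemma prodB_orthogonal_add a b c : a ⊙ b = 0 -> c · (a ⊕ b) = c · a ⊕ c · b.
Proof.
move=> ab0; rewrite [LHS](@mv_le_sub_add _ (c · b)); last first.
  by apply: prodB_mono; exact: mv_le_addl.
by rewrite -prodB mv_orthogonal_addK.
Qed.

End SubDistributive.

Lemma PMV_1_sub_PMV_f : PMV_1 `<=` PMV_f.
Proof.
move=> A [produ prodB].
have le_prod (a b : A) : a · b ≤ a.
  by rewrite -[X in _ ≤ X]produ; apply: prodB_mono (mv_lexu b).
split; [split; [|split]|split=> //] => [a|a b c|a b c|a b].
- by rewrite (mvp_prodC 0); split; exact: prodB_x0.
- exact: prodB_subadditive.
- by rewrite prodB; exact: mv_le_refl.
- by apply/mv_le_meet; split; last rewrite mvp_prodC; exact: le_prod.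
Qed.

Lemma PMV_f_sub_PMV : PMV_f `<=` PMV.
Proof.
move=> A [_ [le_meet prodB]]; split=> a b c; last exact: prodB_orthogonal_add.
by apply: mv_orthogonal_le; apply: mv_le_trans (le_meet _ _) (mv_meet_lel _ _).
Qed.

(** * Products additive on orthogonal sums *)

Section OrthogonalAdditive.
Variable A : mvProdAlgebra.
Hypothesis PMV_A : PMV A.
Implicit Types a b c : A.

Lemma PMV_prodx0 c : c · 0 = 0.
Proof.
have [orth addO] := PMV_A.
have orth00 : (0 : A) ⊙ 0 = 0 by apply/mv_orthogonalE/mv_le0x.
apply: mv_idempotent_orthogonal_eq0; first by rewrite -addO // mv_add0.
by rewrite mvp_prodC; exact: orth.
Qed.

Lemma PMV_prod_split a b c : b ≤ c -> a · c = a · (c ⊖ b) ⊕ a · b.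
Proof.
have [_ addO] := PMV_A.
by move=> /mv_le_sub_add {1}->; apply: addO; exact: mv_sub_orthogonal.
Qed.

Lemma PMV_mono a b c : b ≤ c -> a · b ≤ a · c.
Proof. by move=> /PMV_prod_split ->; exact: mv_le_addl. Qed.

(** Truncation only shrinks the summand [c] to [(b ⊕ c) ⊖ b ≤ c], after which
    the sum is orthogonal and the product is additive on it. *)
Lemma PMV_subadditive a b c : a · (b ⊕ c) ≤ a · b ⊕ a · c.
Proof.
have le_b : b ≤ b ⊕ c by rewrite mv_addC; exact: mv_le_addl.
rewrite (PMV_prod_split a le_b) mv_addC.
apply/mv_le_add2l/PMV_mono/mv_residuation; exact: mv_le_refl.
Qed.

(** By residuation, since [b ≤ c ⊕ (b ⊖ c)], this is subadditivity. *)
Lemma PMV_sub_prod_le a b c : a · b ⊖ a · c ≤ a · (b ⊖ c).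
Proof.
apply/mv_residuation/(mv_le_trans _ (PMV_subadditive _ _ _))/PMV_mono.
by apply/mv_residuation/mv_le_refl.
Qed.

End OrthogonalAdditive.

Lemma PMV_sub_MVW_rig : PMV `<=` MVW_rig.
Proof.
move=> A PMV_A; split; [|split] => [a||].
- by rewrite (mvp_prodC 0); split; exact: PMV_prodx0.
- exact: PMV_subadditive.
- exact: PMV_sub_prod_le.
Qed.

(** * Two products on the three-element chain *)

Inductive luk3 : Type := Zero | Half | One.

Definition luk3_add x y : luk3 :=
  match x, y with
  | Zero, z | z, Zero => z
  | _, _ => One
  end.

Definition luk3_neg x : luk3 :=
  match x with Zero => One | Half => Half | One => Zero end.

Definition luk3_mv : mvAlgebra.
Proof.
by refine (@MVAlgebra luk3 Zero luk3_add luk3_neg _ _ _ _ _ _);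
  repeat case.
Defined.

Definition luk3_zero_prod : mvProdAlgebra.
Proof. by refine (@MVProdAlgebra luk3_mv (fun _ _ => Zero) _ _). Defined.

Definition support_prod x y : luk3 :=
  match x, y with
  | Zero, _ | _, Zero => Zero
  | _, _ => One
  end.

Definition luk3_support_prod : mvProdAlgebra.
Proof.
by refine (@MVProdAlgebra luk3_mv support_prod _ _); repeat case.
Defined.

Lemma PMV_f_luk3_zero_prod : PMV_f luk3_zero_prod.
Proof.
split; [split; [|split]|split] => //= a b; apply/mv_le_meet.
by split; exact: mv_le0x.
Qed.

Lemma not_PMV_1_luk3_zero_prod : ~ PMV_1 luk3_zero_prod.
Proof. by move=> [/(_ One)]. Qed.

Lemma MVW_rig_luk3_support_prod : MVW_rig luk3_support_prod.
Proof. by split; [|split]; repeat case. Qed.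

Lemma not_PMV_luk3_support_prod : ~ PMV luk3_support_prod.
Proof. by move=> [/(_ Half Half One erefl)]. Qed.

Local Close Scope mv_scope.

Theorem theorem3p7 :
  PMV_1 `<` PMV_f /\ PMV_f `<=` PMV /\ PMV `<` MVW_rig.
Proof.
split; [|split].
- split; first exact: PMV_1_sub_PMV_f.
  by move=> /(_ _ PMV_f_luk3_zero_prod) /not_PMV_1_luk3_zero_prod.
- exact: PMV_f_sub_PMV.
- split; first exact: PMV_sub_MVW_rig.
  by move=> /(_ _ MVW_rig_luk3_support_prod) /not_PMV_luk3_support_prod.
Qed.
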